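(* Let $f$ be a field, $L$ a Lie $f$-algebra, $T$ a representation of $L$ in an $f$-space $V$ with basis $(e_i)_{i\in I}$, $I$ linearly ordered, and let $D$ be the diagram of $T$ corresponding to this basis. Then $S^nD$ is the diagram of the representation $S^nT$ of $L$ in $S^nV=V^{\otimes n}/\mathcal{I}_n$, corresponding to the basis $(e_{i_1}\cdots e_{i_n})_{(i_1,\dots,i_n)\in S^nI}$. Here $\mathcal{I}_n$ is the subspace of $V^{\otimes n}$ spanned by the elements $e_\alpha-e_{\alpha^s}$ with $\alpha\in I^n$ and $s\in S_n$ (the symmetric group, $\alpha^s$ being $\alpha$ permuted by $s$), $e_{i_1\dots i_n}=e_{i_1}\otimes\dots\otimes e_{i_n}$, and $e_{i_1}\cdots e_{i_n}$ is the projection of $e_{i_1\dots i_n}$ to $S^nV$.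
   Context: $L^\ast=\mathrm{Hom}_f(L,f)$. The diagram of a representation $T$ of $L$ corresponding to a basis $(e_i)_{i\in I}$ is the directed graph (loops allowed, no multiple edges) with vertex set $I$ having an edge $(i,j)$ iff the linear form $w(i,j)\in L^\ast$, $w(i,j)(l)=$ the coefficient of $e_j$ in $T(l)e_i$, is non-zero; the edge is then labeled by (has weight) $w(i,j)$. When there is no edge $(i,j)$, $w(i,j)=0$. A reduced weighted directed graph is one without multiple edges and with non-zero weights. For a reduced weighted directed graph $G$ with linearly ordered vertex set $V(G)$, $S^nG$ is the reduced weighted directed graph with vertex set $S^nV(G)=\{(v_1,\dots,v_n)\in V(G)^n: v_1\le\dots\le v_n\}$ and the following edges. For $A\in V(S^nG)$ let $v_i(A)$ be its $i$-th entry and $\mathrm{Pr}_i(A)\in V(S^{n-1}G)$ the sequence obtained by erasing the $i$-th entry. For $A\ne B$, the edge $(A,B)$ exists iff for some $i,j$ one has $\mathrm{Pr}_i(A)=\mathrm{Pr}_j(B)$, there is an edge $(v_i(A),v_j(B))$ in $G$, and $(\#\text{ of entries equal to }v_i(A)\text{ in }A)\cdot w(v_i(A),v_j(B))\ne 0$; this element is then the weight of $(A,B)$. The loop $(A,A)$ exists iff $\sum_{i=1}^n w(v_i(A),v_i(A))\neq 0$, and this sum is then its weight. *)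

(* Defs.v *)
From HB Require Import structures.
From mathcomp Require Import all_boot all_order all_algebra all_fingroup.
From mathcomp Require Import boolp.
From mathcomp Require Import finmap monalg zify.

Set Implicit Arguments.
Unset Strict Implicit.
Unset Printing Implicit Defensive.

Import Order.TTheory GRing.Theory.
Local Open Scope ring_scope.

HB.mixin Record Lmodule_isLieAlgebra (f : fieldType) L of GRing.Lmodule f L := {
  lie : L -> L -> L;
  lie_linearl : forall y, linear (lie^~ y);
  lie_linearr : forall x, linear (lie x);
  liexx : forall x, lie x x = 0;
  lie_jacobi : forall x y z,
    lie x (lie y z) + lie y (lie z x) + lie z (lie x y) = 0
}.

#[short(type="lieAlgType")]
HB.structure Definition LieAlgebra (f : fieldType) :=
  {L of Lmodule_isLieAlgebra f L & GRing.Lmodule f L}.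

Record representation (f : fieldType) (L : lieAlgType f) (V : lmodType f) :=
  Representation {
    rep_fun :> L -> {linear V -> V};
    rep_linear : forall a x y v,
      rep_fun (a *: x + y) v = a *: rep_fun x v + rep_fun y v;
    rep_lie : forall x y v,
      rep_fun (lie x y) v = rep_fun x (rep_fun y v) - rep_fun y (rep_fun x v)
  }.

Definition dual (f : fieldType) (L : lmodType f) := {linear L -> f^o}.

Section Dual.
Variables (f : fieldType) (L : lmodType f).
Implicit Types u v w : dual L.

Lemma dualP u v : (forall l, u l = v l) -> u = v.
Proof.
case: u v => [u [[Hu1] [Hu2]]] [v [[Hv1] [Hv2]]] /= /funext uv; subst v.
by rewrite (Prop_irrelevance Hu1 Hv1) (Prop_irrelevance Hu2 Hv2).
Qed.

HB.instance Definition _ := gen_eqMixin (dual L).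
HB.instance Definition _ := gen_choiceMixin (dual L).

Definition dual0 : dual L := \0.
Definition dualN u : dual L := \- u.
Definition dualD u v : dual L := u \+ v.

Fact dualDA : associative dualD.
Proof. by move=> u v w; apply: dualP => l /=; rewrite addrA. Qed.
Fact dualDC : commutative dualD.
Proof. by move=> u v; apply: dualP => l /=; rewrite addrC. Qed.
Fact dual0D : left_id dual0 dualD.
Proof. by move=> u; apply: dualP => l /=; rewrite add0r. Qed.
Fact dualND : left_inverse dual0 dualN dualD.
Proof. by move=> u; apply: dualP => l /=; rewrite addNr. Qed.
HB.instance Definition _ := GRing.isZmodule.Build (dual L)
  dualDA dualDC dual0D dualND.

Lemma dual0E l : (0 : dual L) l = 0. Proof. by []. Qed.
Lemma dualDE u v l : (u + v : dual L) l = u l + v l. Proof. by []. Qed.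
Lemma dualNE u l : (- u : dual L) l = - u l. Proof. by []. Qed.
Lemma dual_sumE (J : Type) (r : seq J) (P : pred J) (F : J -> dual L) l :
  (\sum_(j <- r | P j) F j : dual L) l = \sum_(j <- r | P j) F j l.
Proof.
by apply: (big_morph (fun u : dual L => u l)) => [u v|];
  rewrite ?dualDE ?dual0E.
Qed.
Lemma dualMnE u k l : (u *+ k : dual L) l = u l *+ k.
Proof. by elim: k => [|k IH]; rewrite ?mulr0n // !mulrS dualDE IH. Qed.

End Dual.

Section Basis.
Variables (f : fieldType) (V : lmodType f) (X : choiceType) (e : X -> V).
Implicit Types c : {malg f[X]}.

(* {malg f[X]} is the space of finitely supported functions X -> f, with
   << a *g x >> the function a at x and 0 elsewhere. *)
Definition lincomb c : V := \sum_(x <- msupp c) c@_x *: e x.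

Lemma lincombEw c (D : {fset X}) : (msupp c `<=` D)%fset ->
  lincomb c = \sum_(x <- D) c@_x *: e x.
Proof.
move=> sub; rewrite /lincomb (big_fset_incl _ sub) // => x _ xN.
by rewrite mcoeff_outdom // scale0r.
Qed.

Fact lincomb_linear : linear lincomb.
Proof.
move=> a c1 c2.
set D := (msupp c1 `|` msupp c2)%fset.
have h1 : (msupp c1 `<=` D)%fset by apply: fsubsetUl.
have h2 : (msupp c2 `<=` D)%fset by apply: fsubsetUr.
have h3 : (msupp (a *: c1 + c2) `<=` D)%fset.
  apply: (fsubset_trans (msuppD_le _ _)); apply: fsetSU.
  exact: msuppZ_le.
rewrite (lincombEw h1) (lincombEw h2) (lincombEw h3).
rewrite scaler_sumr -big_split /=; apply: eq_bigr => x _.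
by rewrite mcoeffD mcoeffZ scalerDl scalerA.
Qed.
HB.instance Definition _ :=
  GRing.isLinear.Build f {malg f[X]} V *:%R lincomb lincomb_linear.

Lemma lincombU x a : lincomb << a *g x >> = a *: e x.
Proof.
by rewrite (lincombEw msuppU_le) big_seq_fset1 mcoeffUU.
Qed.

Definition is_basis : Prop :=
  (forall v, exists c, v = lincomb c) /\ (forall c, lincomb c = 0 -> c = 0).

Hypothesis he : is_basis.

(* The choice is unique: see lincombK. *)
Definition coord (v : V) : {malg f[X]} := projT1 (cid (he.1 v)).

Lemma coordK v : lincomb (coord v) = v.
Proof. by rewrite /coord; case: cid. Qed.

Lemma lincombK c : coord (lincomb c) = c.
Proof.
apply/eqP; rewrite -subr_eq0; apply/eqP/he.2.
by rewrite linearB /= coordK subrr.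
Qed.

Lemma coord_linear : linear coord.
Proof.
move=> a u v.
by rewrite -[in LHS](coordK u) -[in LHS](coordK v) -linearP lincombK.
Qed.

End Basis.

(* Reduced weighted directed graph on the vertex set X, weights in W: the
   weight of an absent edge is 0, and an edge never has weight 0. *)
Record wdigraph (W : zmodType) (X : Type) := WDigraph {
  edge : rel X;
  weight : X -> X -> W;
  edgeE : forall x y, edge x y = (weight x y != 0)
}.

Lemma wdigraphP (W : zmodType) (X : Type) (G H : wdigraph W X) :
  (forall x y, weight G x y = weight H x y) -> G = H.
Proof.
case: G H => [eG wG hG] [eH wH hH] /= wE.
have wGH : wG = wH by apply/funext => x; apply/funext => y.
subst wH; have eGH : eG = eH.
  by apply/funext => x; apply/funext => y; rewrite hG hH.
by subst eH; rewrite (Prop_irrelevance hG hH).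
Qed.

Section Diagram.
Variables (f : fieldType) (L : lieAlgType f) (V : lmodType f).
Variables (T : representation L V).
Variables (X : choiceType) (e : X -> V) (he : is_basis e).

Definition diagram_form (i j : X) (l : L) : f^o := (coord he (T l (e i)))@_j.

Fact diagram_form_linear i j : linear (diagram_form i j).
Proof.
move=> a x y.
by rewrite /diagram_form rep_linear coord_linear mcoeffD mcoeffZ.
Qed.
HB.instance Definition _ i j :=
  GRing.isLinear.Build f L f^o *:%R (diagram_form i j) (diagram_form_linear i j).

Definition diagram_weight (i j : X) : dual L := diagram_form i j.

Definition diagram : wdigraph (dual L) X :=
  @WDigraph _ _ (fun i j => diagram_weight i j != 0) diagram_weight
    (fun i j => erefl).

End Diagram.

Definition sym_vertex d (I : orderType d) (n : nat) :=
  {A : n.-tuple I | sorted <=%O A}.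

Section SymGraph.
Variables (d : Order.disp_t) (I : orderType d) (n : nat).
HB.instance Definition _ := Choice.on (sym_vertex I n).

Implicit Types A B : sym_vertex I n.

Definition entry A (i : 'I_n) : I := tnth (val A) i.

(* Erasing an entry of a sorted sequence leaves it sorted, so this is (the
   sequence underlying) a vertex of the (n-1)-st symmetric power. *)
Definition erase A (i : 'I_n) : seq I := take i (val A) ++ drop i.+1 (val A).

Variables (W : zmodType) (G : wdigraph W I).

Definition sym_edge_weight A B (ij : 'I_n * 'I_n) : W :=
  weight G (entry A ij.1) (entry B ij.2) *+ count_mem (entry A ij.1) (val A).

Definition sym_edge_via A B (ij : 'I_n * 'I_n) : bool :=
  [&& erase A ij.1 == erase B ij.2, edge G (entry A ij.1) (entry B ij.2)
    & sym_edge_weight A B ij != 0].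

Definition sym_loop_weight A : W := \sum_(i < n) weight G (entry A i) (entry A i).

Definition sym_edge A B : bool :=
  if A == B then sym_loop_weight A != 0 else [exists ij, sym_edge_via A B ij].

(* Any (i, j) that defines the edge gives the same weight: see sym_weightE. *)
Definition sym_weight A B : W :=
  if A == B then sym_loop_weight A
  else if [pick ij | sym_edge_via A B ij] is Some ij
       then sym_edge_weight A B ij else 0.

Fact sym_edgeE A B : sym_edge A B = (sym_weight A B != 0).
Proof.
rewrite /sym_edge /sym_weight; case: eqP => // _.
case: pickP => [ij Hij|none]; last by rewrite eqxx; apply/existsP => -[ij]; rewrite none.
by case/and3P: (Hij) => _ _ ->; apply/existsP; exists ij.
Qed.

Definition sym_graph : wdigraph W (sym_vertex I n) := WDigraph sym_edgeE.

Lemma perm_erase A i : perm_eq (val A) (entry A i :: erase A i).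
Proof.
rewrite /entry /erase (tnth_nth (tnth (val A) i)).
rewrite -{1}(cat_take_drop i (val A)) (drop_nth (tnth (val A) i)) ?size_tuple //.
by rewrite perm_catC /= perm_cons perm_catC.
Qed.

Lemma erase_entry_neq A B i j :
  A != B -> erase A i = erase B j -> entry A i != entry B j.
Proof.
move=> /eqP AB eqE; apply/eqP => eqv; apply: AB; apply/val_inj/val_inj => /=.
apply: (@le_sorted_eq _ _ _ _ (valP A) (valP B)).
by rewrite (perm_trans (perm_erase A i)) // eqE eqv perm_sym perm_erase.
Qed.

Lemma erase_entry_uniq A B i j i' j' : A != B ->
  erase A i = erase B j -> erase A i' = erase B j' ->
  entry A i = entry A i' /\ entry B j = entry B j'.
Proof.
move=> AB E E'.
have cnt (C : sym_vertex I n) k x : count_mem x (val C) =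
    ((entry C k == x) + count_mem x (erase C k))%N.
  by rewrite (seq.permP (perm_erase C k)).
have N := erase_entry_neq AB E; have N' := erase_entry_neq AB E'.
split; apply/eqP.
- have := cnt A i (entry A i); rewrite (cnt A i').
  have := cnt B j (entry A i); rewrite (cnt B j').
  rewrite -E -E' eqxx [entry B j == _]eq_sym (negbTE N).
  rewrite [entry A i == entry A i']eq_sym.
  by case: (entry A i' == entry A i); lia.
- have := cnt A i (entry B j); rewrite (cnt A i').
  have := cnt B j (entry B j); rewrite (cnt B j').
  rewrite -E -E' eqxx (negbTE N).
  rewrite [entry B j == entry B j']eq_sym.
  by case: (entry B j' == entry B j); lia.
Qed.

Lemma sym_weightE A B ij : A != B -> sym_edge_via A B ij ->
  sym_weight A B = sym_edge_weight A B ij.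
Proof.
move=> AB Hij; rewrite /sym_weight (negbTE AB).
case: pickP => [kl Hkl|/(_ ij)]; last by rewrite Hij.
case/and3P: Hij Hkl => /eqP E _ _ /and3P[/eqP E' _ _].
by rewrite /sym_edge_weight; have [-> ->] := erase_entry_uniq AB E E'.
Qed.

End SymGraph.

Section Span.
Variables (f : fieldType) (V : lmodType f) (P : V -> Prop).

Definition span : {pred V} := fun v => `[< exists s : seq (f * V),
  (forall p, p \in s -> P p.2) /\ v = \sum_(p <- s) p.1 *: p.2 >].

Fact span_submod_closed : submod_closed span.
Proof.
split; first by apply/asboolP; exists [::]; rewrite big_nil.
move=> a u v /asboolP[s [sP ->]] /asboolP[t [tP ->]]; apply/asboolP.
exists ([seq (a * p.1, p.2) | p <- s] ++ t); split.
  by move=> p; rewrite mem_cat => /orP[/mapP[q /sP Pq ->]|/tP].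
rewrite big_cat big_map /= scaler_sumr; congr (_ + _).
by apply: eq_bigr => p _; rewrite scalerA.
Qed.
HB.instance Definition _ := GRing.isSubmodClosed.Build f V span span_submod_closed.

Lemma span_gen v : P v -> v \in span.
Proof.
move=> Pv; apply/asboolP; exists [:: (1, v)]; split; last by rewrite big_seq1 scale1r.
by move=> p; rewrite inE => /eqP ->.
Qed.

Lemma span_ind (U : lmodType f) (g : {linear V -> U}) :
  (forall v, P v -> g v = 0) -> forall v, v \in span -> g v = 0.
Proof.
move=> gP v /asboolP[s [sP ->]]; rewrite linear_sum big_seq big1 //= => p /sP Pp.
by rewrite linearZ /= gP // scaler0.
Qed.
End Span.

Section QuotientModule.
Variables (f : fieldType) (V : lmodType f) (P : V -> Prop).

(* V modulo the subspace spanned by P. *)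
Definition quot_mod := Quotient.quot (span P).
HB.instance Definition _ := GRing.Zmodule.on quot_mod.

Definition qproj (v : V) : quot_mod := (\pi_(Quotient.quot (span P)) v)%qT.
Definition qrepr (x : quot_mod) : V := generic_quotient.repr (x : Quotient.quot (span P)).

Lemma qreprK x : qproj (qrepr x) = x. Proof. exact: reprK. Qed.

Lemma qprojP u v : qproj u = qproj v <-> u - v \in span P.
Proof.
rewrite /qproj Quotient.idealrBE; split=> [->|/eqP//]; exact: eqxx.
Qed.

Fact qprojB u v : qproj (u - v) = qproj u - qproj v.
Proof. by rewrite /qproj; rewrite !piE. Qed.

Definition qscale (a : f) (x : quot_mod) : quot_mod := qproj (a *: qrepr x).

Lemma qscaleE a v : qscale a (qproj v) = qproj (a *: v).
Proof.
apply/qprojP; rewrite -scalerBr; apply: rpredZ.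
by apply/qprojP; rewrite qreprK.
Qed.

Fact qprojD u v : qproj (u + v) = qproj u + qproj v.
Proof. by rewrite /qproj !piE. Qed.

Fact qscaleA a b x : qscale a (qscale b x) = qscale (a * b) x.
Proof. by rewrite -(qreprK x) !qscaleE scalerA. Qed.
Fact qscale1 : left_id 1 qscale.
Proof. by move=> x; rewrite -(qreprK x) qscaleE scale1r. Qed.
Fact qscaleDr : right_distributive qscale +%R.
Proof.
by move=> a x y; rewrite -(qreprK x) -(qreprK y) -qprojD !qscaleE scalerDr qprojD.
Qed.
Fact qscaleDl x : {morph qscale^~ x : a b / a + b}.
Proof. by move=> a b; rewrite -(qreprK x) !qscaleE scalerDl qprojD. Qed.
HB.instance Definition _ := GRing.Zmodule_isLmodule.Build f quot_mod
  qscaleA qscale1 qscaleDr qscaleDl.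

Fact qproj_linear : linear qproj.
Proof. by move=> a u v; rewrite qprojD -qscaleE. Qed.
HB.instance Definition _ :=
  GRing.isLinear.Build f V quot_mod *:%R qproj qproj_linear.

Variables (U : lmodType f) (g : {linear V -> U}).

Definition qlift_fun (_ : forall v, v \in span P -> g v = 0) (x : quot_mod) : U :=
  g (qrepr x).

Hypothesis gS : forall v, v \in span P -> g v = 0.

Lemma qlift_funE v : qlift_fun gS (qproj v) = g v.
Proof.
apply/eqP; rewrite -subr_eq0 -linearB; apply/eqP/gS.
by apply/qprojP; rewrite qreprK.
Qed.

Fact qlift_linear : linear (qlift_fun gS).
Proof.
move=> a x y; rewrite -(qreprK x) -(qreprK y) -linearP !qlift_funE.
by rewrite linearP.
Qed.
HB.instance Definition _ :=
  GRing.isLinear.Build f quot_mod U *:%R (qlift_fun gS) qlift_linear.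

Definition qlift : {linear quot_mod -> U} := qlift_fun gS.

Lemma qliftE v : qlift (qproj v) = g v. Proof. exact: qlift_funE. Qed.

End QuotientModule.

Section TensorPower.
Variables (f : fieldType) (V : lmodType f) (n : nat).
Implicit Types v : {ffun 'I_n -> V}.

Definition subst_at v (i : 'I_n) (x : V) : {ffun 'I_n -> V} :=
  [ffun j => if j == i then x else v j].

Definition multilinear (U : lmodType f) (m : {ffun 'I_n -> V} -> U) : Prop :=
  forall v i, linear (fun x => m (subst_at v i x)).

Definition multilinear_at_fun (U : lmodType f) (m : {ffun 'I_n -> V} -> U)
  (_ : multilinear m) v i (x : V) : U := m (subst_at v i x).
HB.instance Definition _ U m (hm : @multilinear U m) v i :=
  GRing.isLinear.Build f V U *:%R (multilinear_at_fun hm v i) (hm v i).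
Definition multilinear_at U m (hm : @multilinear U m) v i : {linear V -> U} :=
  multilinear_at_fun hm v i.

Definition tensor_relation (w : {malg f[{ffun 'I_n -> V}]}) : Prop :=
  exists v i a x y,
    w = << subst_at v i (a *: x + y) >>
        - (a *: << subst_at v i x >> + << subst_at v i y >>).

(* The free space on n-tuples of vectors modulo the multilinearity relations. *)
Definition tensor_power := quot_mod tensor_relation.
HB.instance Definition _ := GRing.Lmodule.on tensor_power.

Definition tensor v : tensor_power := qproj tensor_relation << v >>.

Lemma tensor_multilinear : multilinear tensor.
Proof.
move=> v i a x y; rewrite /tensor -linearP; apply/qprojP/span_gen.
by exists v, i, a, x, y.
Qed.

Section Lift.
Variables (U : lmodType f) (m : {ffun 'I_n -> V} -> U).
Hypothesis hm : multilinear m.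

Fact tensor_lift_subproof w : w \in span tensor_relation -> lincomb m w = 0.
Proof.
apply: span_ind => {}w [v [i [a [x [y ->]]]]].
by rewrite linearB linearP /= !lincombU !scale1r hm subrr.
Qed.

Definition tensor_lift : {linear tensor_power -> U} :=
  qlift tensor_lift_subproof.

Lemma tensor_liftE v : tensor_lift (tensor v) = m v.
Proof. by rewrite /tensor_lift /tensor qliftE /= lincombU scale1r. Qed.
End Lift.

Lemma tensor_ext (U : lmodType f) (g h : {linear tensor_power -> U}) :
  (forall v, g (tensor v) = h (tensor v)) -> forall x, g x = h x.
Proof.
move=> gh x; rewrite -(qreprK x) (monalgE (qrepr x)) !linear_sum /=.
apply: eq_bigr => v _.
have -> : << (qrepr x)@_v *g v >> = (qrepr x)@_v *: << v >> :> {malg f[_]}.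
  by apply/malgP => k; rewrite mcoeffZ !mcoeffU mulrnAr mulr1.
by rewrite !linearZ /= gh.
Qed.

Lemma subst_at_id v i : subst_at v i (v i) = v.
Proof. by apply/ffunP => j; rewrite ffunE; case: eqP => [->|]. Qed.

Lemma subst_at_at v i x : subst_at v i x i = x.
Proof. by rewrite ffunE eqxx. Qed.

Lemma subst_at_neq v i x j : j != i -> subst_at v i x j = v j.
Proof. by rewrite ffunE => /negbTE ->. Qed.

Lemma subst_at_twice v i x y : subst_at (subst_at v i x) i y = subst_at v i y.
Proof. by apply/ffunP => j; rewrite !ffunE; case: eqP. Qed.

Lemma subst_atC v i j x y : i != j ->
  subst_at (subst_at v i x) j y = subst_at (subst_at v j y) i x.
Proof.
move=> ij; apply/ffunP => k; rewrite !ffunE.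
case: (k =P j) => [->|//]; case: eqP => // ji; by rewrite ji eqxx in ij.
Qed.

Lemma multilinear_ext (U : lmodType f) (X : choiceType) (e : X -> V)
    (m1 m2 : {ffun 'I_n -> V} -> U) :
  (forall x : V, exists c, x = lincomb e c) -> multilinear m1 -> multilinear m2 ->
  (forall a : {ffun 'I_n -> X}, m1 [ffun i => e (a i)] = m2 [ffun i => e (a i)]) ->
  forall v, m1 v = m2 v.
Proof.
move=> he hm1 hm2 agree.
suff H k : (k <= n)%N -> forall v,
    (forall i : 'I_n, (k <= i)%N -> exists x, v i = e x) -> m1 v = m2 v.
  by move=> v; apply: (H n) => // i; rewrite leqNgt ltn_ord.
elim: k => [_ v hv|k IH ltkn v hv].
  have hv' i : exists x, v i = e x by apply: hv.
  have -> : v = [ffun i => e ([ffun i => projT1 (cid (hv' i))] i)].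
    by apply/ffunP => i; rewrite !ffunE; case: cid.
  exact: agree.
pose i := Ordinal ltkn.
have [c vic] := he (v i).
have mE (m : {ffun 'I_n -> V} -> U) : multilinear m ->
    m v = \sum_(x <- msupp c) c@_x *: m (subst_at v i (e x)).
  move=> hm; rewrite -{1}(subst_at_id v i) vic.
  rewrite -[LHS]/(multilinear_at hm v i (lincomb e c)) linear_sum; apply: eq_bigr => x _.
  by rewrite linearZ.
rewrite (mE m1) // (mE m2) //; apply: eq_bigr => x _; congr (_ *: _).
apply: IH => [|j lekj]; first exact: ltnW.
have [->|ji] := eqVneq j i; first by exists x; rewrite subst_at_at.
rewrite subst_at_neq //; apply: hv; rewrite ltn_neqAle lekj andbT.
by apply: contraNneq ji => kj; apply/eqP/val_inj.
Qed.

End TensorPower.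

Section TensorAction.
Variables (f : fieldType) (L : lieAlgType f) (V : lmodType f).
Variables (T : representation L V) (n : nat).
Implicit Types v : {ffun 'I_n -> V}.

Definition tensor_act_fun (l : L) v : tensor_power V n :=
  \sum_(i < n) tensor (subst_at v i (T l (v i))).

Fact tensor_act_multilinear l : multilinear (tensor_act_fun l).
Proof.
move=> v i a x y; rewrite /tensor_act_fun scaler_sumr -big_split /=.
apply: eq_bigr => j _; have [->|ji] := eqVneq j i.
  by rewrite !subst_at_at !subst_at_twice linearP tensor_multilinear.
rewrite !(subst_at_neq _ _ ji) !(subst_atC _ _ _ (_ : i != j)) 1?eq_sym //.
exact: tensor_multilinear.
Qed.

Definition tensor_act (l : L) : {linear tensor_power V n -> tensor_power V n} :=
  tensor_lift (tensor_act_multilinear l).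

Lemma tensor_actE l v :
  tensor_act l (tensor v) = \sum_(i < n) tensor (subst_at v i (T l (v i))).
Proof. exact: tensor_liftE. Qed.

Arguments tensor_act : simpl never.

Fact tensor_act_linear a x y t :
  tensor_act (a *: x + y) t = a *: tensor_act x t + tensor_act y t.
Proof.
pose h : {linear tensor_power V n -> tensor_power V n} :=
  (a \*: tensor_act x) \+ tensor_act y.
apply: (tensor_ext (h := h)) => v.
rewrite -[RHS]/(a *: tensor_act x (tensor v) + tensor_act y (tensor v)).
rewrite !tensor_actE scaler_sumr -big_split.
by apply: eq_bigr => i _ /=; rewrite rep_linear tensor_multilinear.
Qed.

Fact tensor_act_lie x y t : tensor_act (lie x y) t =
  tensor_act x (tensor_act y t) - tensor_act y (tensor_act x t).
Proof.
pose h : {linear tensor_power V n -> tensor_power V n} :=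
  (tensor_act x \o tensor_act y) \- (tensor_act y \o tensor_act x).
apply: (tensor_ext (h := h)) => v.
rewrite -[RHS]/(tensor_act x (tensor_act y (tensor v))
                - tensor_act y (tensor_act x (tensor v))).
rewrite !tensor_actE (linear_sum (tensor_act x)) (linear_sum (tensor_act y)).
have E z w : \sum_(i < n) tensor_act z (tensor (subst_at v i (T w (v i)))) =
    \sum_(i < n) tensor (subst_at v i (T z (T w (v i)))) +
    \sum_(i < n) \sum_(j < n | j != i)
       tensor (subst_at (subst_at v i (T w (v i))) j (T z (v j))).
  rewrite -big_split; apply: eq_bigr => i _.
  rewrite tensor_actE (bigD1 i) //= subst_at_at subst_at_twice; congr (_ + _).
  by apply: eq_bigr => j ji; rewrite subst_at_neq.
rewrite (E x y) (E y x) opprD addrACA -sumrB.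
have -> : \sum_(i < n) \sum_(j < n | j != i)
    tensor (subst_at (subst_at v i (T y (v i))) j (T x (v j))) =
  \sum_(i < n) \sum_(j < n | j != i)
    tensor (subst_at (subst_at v i (T x (v i))) j (T y (v j))).
  rewrite (exchange_big_dep predT) //=; apply: eq_bigr => j _.
  apply: eq_big => [i|i ji]; first by rewrite /= eq_sym.
  by rewrite subst_atC // eq_sym.
rewrite subrr addr0; apply: eq_bigr => i _; rewrite rep_lie.
by rewrite -[LHS]/(multilinear_at (@tensor_multilinear f V n) v i _) linearB.
Qed.

Definition tensor_rep : representation L (tensor_power V n) :=
  Representation tensor_act_linear tensor_act_lie.

End TensorAction.

Section SymmetricPower.
Variables (f : fieldType) (V : lmodType f) (X : choiceType) (e : X -> V).
Variable n : nat.

Definition basis_tensor (a : {ffun 'I_n -> X}) : tensor_power V n :=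
  tensor [ffun i => e (a i)].

(* Left and right conventions for a^s give the same family, as s ranges over a
   group. *)
Definition sym_relation (w : tensor_power V n) : Prop :=
  exists (a : {ffun 'I_n -> X}) (s : 'S_n),
    w = basis_tensor a - basis_tensor [ffun i => a (s i)].

Definition sym_power := quot_mod sym_relation.
HB.instance Definition _ := GRing.Lmodule.on sym_power.

Definition sym_proj : {linear tensor_power V n -> sym_power} :=
  qproj sym_relation.

End SymmetricPower.

Section SymmetricRep.
Variables (f : fieldType) (L : lieAlgType f) (V : lmodType f).
Variables (T : representation L V).
Variables (X : choiceType) (e : X -> V) (he : is_basis e) (n : nat).

Lemma sym_proj_perm (v : {ffun 'I_n -> V}) (s : 'S_n) :
  sym_proj e n (tensor v) = sym_proj e n (tensor [ffun i => v (s i)]).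
Proof.
apply: (multilinear_ext he.1 (m1 := fun v => sym_proj e n (tensor v))
  (m2 := fun v => sym_proj e n (tensor [ffun i => v (s i)]))).
- by move=> u i a x y /=; rewrite tensor_multilinear linearP.
- move=> u i a x y.
  have E z : [ffun k => subst_at u i z (s k)] =
      subst_at [ffun k => u (s k)] (s^-1 i)%g z.
    by apply/ffunP => k; rewrite !ffunE (canF_eq (permK s)).
  by rewrite !E tensor_multilinear linearP.
- move=> a; apply/qprojP/span_gen; exists a, s; congr (_ - tensor _).
  by apply/ffunP => i; rewrite !ffunE.
Qed.

Fact sym_act_subproof l w :
  w \in span (sym_relation e (n := n)) ->
  (sym_proj e n \o tensor_rep T n l) w = 0.
Proof.
apply: span_ind => {}w [a [s ->]].
rewrite -[LHS]/(sym_proj e n (tensor_act T n l (_ - _))).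
rewrite (linearB (tensor_act T n l)) !tensor_actE (linearB (sym_proj e n)).
rewrite !(linear_sum (sym_proj e n)).
apply/eqP; rewrite subr_eq0; apply/eqP.
rewrite [RHS](reindex_inj (@perm_inj _ (s^-1)%g)) /=.
apply: eq_bigr => i _; rewrite (sym_proj_perm _ s).
congr (sym_proj _ _ (tensor _)); apply/ffunP => k; rewrite !ffunE permKV.
by rewrite (canF_eq (permK s)).
Qed.

Definition sym_act (l : L) : {linear sym_power e n -> sym_power e n} :=
  qlift (@sym_act_subproof l).

Lemma sym_actE l t :
  sym_act l (sym_proj e n t) = sym_proj e n (tensor_rep T n l t).
Proof. exact: qliftE. Qed.

Fact sym_act_linear a x y t :
  sym_act (a *: x + y) t = a *: sym_act x t + sym_act y t.
Proof.
rewrite -(qreprK t) -[qproj _ _]/(sym_proj e n _) !sym_actE.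
by rewrite rep_linear linearP.
Qed.

Fact sym_act_lie x y t :
  sym_act (lie x y) t = sym_act x (sym_act y t) - sym_act y (sym_act x t).
Proof.
rewrite -(qreprK t) -[qproj _ _]/(sym_proj e n _) !sym_actE.
by rewrite rep_lie linearB.
Qed.

Definition sym_rep : representation L (sym_power e n) :=
  Representation sym_act_linear sym_act_lie.

End SymmetricRep.

Definition sym_basis (f : fieldType) (V : lmodType f) d (I : orderType d)
    (e : I -> V) (n : nat) (A : sym_vertex I n) : sym_power e n :=
  sym_proj e n (basis_tensor e [ffun i => entry A i]).
Arguments sym_basis {f V d I} e n A.

(* Main.v *)
(* The coordinate of S^nV at a sorted tuple B is the multilinear form sending
   (v_1, ..., v_n) to the sum, over the distinct rearrangements b of B, of the
   products of the b_i-th coordinates of the v_i: on basis tuples it is the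
   indicator of being a rearrangement of B, hence it is symmetric.  These forms
   are dual to the sorted monomials, which gives their independence, and they
   compute the diagram: the coefficient of e_B in l.e_A is the sum over i of
   w(a_i, b_j), where j is any index with Pr_i(A) = Pr_j(B), if there is one.
   For A <> B the pair of values (a_i, b_j) does not depend on (i, j), so the sum
   is the multiplicity of a_i times w(a_i, b_j); for A = B it is the loop weight. *)
Require Import Defs.
From mathcomp Require Import all_boot all_order all_algebra.
From mathcomp Require Import perm finmap monalg.

Set Implicit Arguments.
Unset Strict Implicit.
Unset Printing Implicit Defensive.

Import Order.TTheory GRing.Theory Defs.
Local Open Scope ring_scope.

(** * Sorted tuples up to rearrangement, with one entry erased or replaced *)

Section Erase.
Variables (d : Order.disp_t) (I : orderType d) (n : nat).
Implicit Types A B : sym_vertex I n.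

Lemma sym_vertex_inj A B : perm_eq (val A) (val B) -> A = B.
Proof.
move=> AB; apply/val_inj/val_inj.
exact: (le_sorted_eq (valP A) (valP B) AB).
Qed.

Lemma erase_sorted A i : sorted <=%O (erase A i).
Proof.
apply: (subseq_sorted le_trans _ (valP A)).
rewrite -[X in subseq _ X](cat_take_drop i) /erase cat_subseq //.
by rewrite -add1n -drop_drop drop_subseq.
Qed.

Lemma erase_eqP A B i j : erase A i = erase B j <-> perm_eq (erase A i) (erase B j).
Proof.
split=> [->//|]; exact: le_sorted_eq (erase_sorted A i) (erase_sorted B j).
Qed.

(** The common erased part cancels when occurrences of [x] are counted. *)
Lemma perm_cons_erase A B i j x : erase A i = erase B j ->
  perm_eq (x :: erase A i) (val B) = (x == entry B j).
Proof.
move=> ->; rewrite (permPr (perm_erase B j)).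
apply/idP/eqP => [/seq.permP/(_ (pred1 x))/eqP|-> //].
by rewrite /= eqxx eqn_add2r; case: (eqVneq (entry B j) x).
Qed.

(** Otherwise [x] would occur in [B] at some position [j], and cancelling it would make the two
    erasures agree. *)
Lemma perm_cons_eraseF A B i x : (forall j, erase A i <> erase B j) ->
  perm_eq (x :: erase A i) (val B) = false.
Proof.
move=> neq; apply/negP => AB.
have: x \in val B by rewrite -(perm_mem AB) mem_head.
case/tnthP=> j xE; apply: (neq j); apply/erase_eqP.
by rewrite -(perm_cons x) {2}xE (permPl AB) perm_erase.
Qed.

Lemma erase_entry A i j : entry A i = entry A j -> erase A i = erase A j.
Proof.
move=> Aij; apply/erase_eqP; rewrite -(perm_cons (entry A i)).
by rewrite -(permPl (perm_erase A i)) Aij perm_erase.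
Qed.

Lemma codom_entry A : codom [ffun i => entry A i] = val A.
Proof.
rewrite -[RHS](map_tnth_enum (val A)) codomE.
by apply: eq_map => i; rewrite ffunE.
Qed.

Lemma count_codom (a : {ffun 'I_n -> I}) (p : pred I) :
  count p (codom a) = (\sum_(i < n) p (a i))%N.
Proof.
rewrite codomE count_map -sum1_count big_enum_cond big_mkcond /=.
by apply: eq_bigr => i _; case: (p _).
Qed.

Lemma codom_subst_entry A i x :
  perm_eq (codom [ffun j => if j == i then x else entry A j]) (x :: erase A i).
Proof.
(* Adding the erased entry to both sides turns the right-hand count into a count in all of [A],
   hence a sum over indices. *)
apply/seq.permP => p; apply/eqP; rewrite -(eqn_add2l (p (entry A i))) /= addnCA.
rewrite -[X in _ == (_ + X)%N]/(count p (entry A i :: erase A i)).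
rewrite -(seq.permP (perm_erase A i)) -(codom_entry A) !count_codom.
rewrite (bigD1 i) //= [X in _ == (_ + X)%N](bigD1 i) //= !ffunE eqxx addnCA.
do 2 rewrite eqn_add2l; apply/eqP; apply: eq_bigr => j /negbTE ji.
by rewrite !ffunE ji.
Qed.

End Erase.

Lemma sum_mcoeff_eq (f : fieldType) (X : choiceType) (c : {malg f[X]}) y :
  \sum_(x <- msupp c) c@_x * (x == y)%:R = c@_y.
Proof.
have [yc|yc] := boolP (y \in msupp c).
  rewrite (big_fsetD1 y) //= eqxx mulr1 big_seq big1 ?addr0 // => x.
  by rewrite !inE => /andP[/negbTE-> _]; rewrite mulr0.
rewrite mcoeff_outdom // big_seq big1 // => x xc.
by case: eqP xc yc => [->->//|_ _ _]; rewrite mulr0.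
Qed.

(** * Coordinate forms on the symmetric power and the basis of sorted monomials *)

Section SymCoord.
Variables (f : fieldType) (V : lmodType f) (d : Order.disp_t) (I : orderType d).
Variables (e : I -> V) (he : is_basis e) (n : nat).
Implicit Types (A B : sym_vertex I n) (v : {ffun 'I_n -> V}).

Lemma coord_basis x : coord he (e x) = << x >>.
Proof. by rewrite -{1}(scale1r (e x)) -lincombU lincombK. Qed.

(* Summing over the distinct rearrangements of [B], rather than over the
   permutations of its indices, keeps the value at [e_B] equal to 1 in every
   characteristic. *)
Definition sym_coord_fun B v : f^o :=
  \sum_(b <- permutations (val B))
    \prod_(i < n) (coord he (v i))@_(nth (entry B i) b i).

Fact sym_coord_multilinear B : multilinear (sym_coord_fun B).
Proof.
move=> v i a x y; rewrite /sym_coord_fun scaler_sumr -big_split /=.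
apply: eq_bigr => b _; rewrite !(bigD1 (P := xpredT) i) //= !subst_at_at.
rewrite coord_linear mcoeffD mcoeffZ.
have E z : \prod_(j < n | j != i)
    (coord he (subst_at v i z j))@_(nth (entry B j) b j) =
    \prod_(j < n | j != i) (coord he (v j))@_(nth (entry B j) b j).
  by apply: eq_bigr => j ji; rewrite subst_at_neq.
by rewrite !E mulrDl -mulrA.
Qed.

(** A rearrangement [b] other than [codom a] differs from [a] at some index, where its product has a
    zero factor. *)
Lemma sym_coord_basis B (a : {ffun 'I_n -> I}) :
  sym_coord_fun B [ffun i => e (a i)] = (perm_eq (codom a) (val B))%:R.
Proof.
rewrite -mem_permutations /sym_coord_fun.
rewrite (eq_big_seq (fun b => (b == codom a)%:R)) => [|b]; last first.
  rewrite mem_permutations => /perm_size; rewrite size_tuple => szb.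
  have [bE|ba] := eqVneq b (codom a).
    rewrite big1 // => i _; rewrite ffunE coord_basis mcoeffU bE codomE.
    by rewrite (nth_map i) ?size_enum_ord // nth_ord_enum eqxx.
  have /existsP[i /negbTE ai] : [exists i : 'I_n, a i != nth (entry B i) b i].
    rewrite -negb_forall; apply: contra ba => /forallP ab.
    (* The default [entry B i] of [nth] varies with [i]; comparing the sequences needs one fixed
       default, available only for positive length. *)
    apply/eqP; case: n B a szb ab => [|m] B' a' szb ab.
      by move/size0nil: szb => ->; apply/esym/size0nil; rewrite size_codom card_ord.
    apply: (@eq_from_nth _ (entry B' ord0)) => [|k].
      by rewrite size_codom card_ord.
    rewrite szb => km; have := ab (Ordinal km); move/eqP.
    rewrite codomE (nth_map ord0) ?size_enum_ord //.
    rewrite (nth_ord_enum ord0 (Ordinal km)) => ->.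
    by apply: set_nth_default; rewrite szb.
  by rewrite (bigD1 i) //= ffunE coord_basis mcoeffU ai mul0r.
(* Without repetitions in the list, [codom a] contributes at most once. *)
have := permutations_uniq (val B).
elim: (permutations _) => [|b s IH]; rewrite ?big_nil // big_cons inE.
case/andP=> bs us; rewrite IH // [codom a == b]eq_sym.
by case: eqP => [<-|_]; rewrite ?(negbTE bs) ?addr0 ?add0r.
Qed.

Fact sym_coord_subproof B w : w \in span (sym_relation e (n := n)) ->
  tensor_lift (sym_coord_multilinear B) w = 0.
Proof.
apply: span_ind => {}w [a [s ->]].
rewrite /basis_tensor (linearB (tensor_lift _)) !tensor_liftE.
rewrite !sym_coord_basis; apply/eqP; rewrite subr_eq0; apply/eqP.
congr (nat_of_bool _)%:R.
suff /permPl : perm_eq (codom a) (codom [ffun i => a (s i)]) by apply.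
apply/seq.permP => p; rewrite !count_codom.
rewrite (reindex_inj (@perm_inj _ s)); apply: eq_bigr => i _.
by rewrite ffunE.
Qed.

Definition sym_coord B : {linear sym_power e n -> f^o} :=
  qlift (@sym_coord_subproof B).

Lemma sym_coordE B v : sym_coord B (sym_proj e n (tensor v)) = sym_coord_fun B v.
Proof. by rewrite /sym_coord qliftE tensor_liftE. Qed.

Lemma sym_coord_sym_basis A B : sym_coord B (sym_basis e n A) = (A == B)%:R.
Proof.
rewrite sym_coordE sym_coord_basis codom_entry; congr (nat_of_bool _)%:R.
by apply/idP/eqP => [/sym_vertex_inj|->].
Qed.

Lemma sym_coord_lincomb B c : sym_coord B (lincomb (sym_basis e n) c) = c@_B.
Proof.
rewrite /lincomb linear_sum -[RHS]sum_mcoeff_eq; apply: eq_bigr => A _.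
by rewrite linearZ sym_coord_sym_basis.
Qed.

(** Sorting [codom a] amounts to permuting the indices, which [sym_proj] does not see. *)
Lemma sym_proj_basis_sort (a : {ffun 'I_n -> I}) :
  exists A, sym_proj e n (basis_tensor e a) = sym_basis e n A.
Proof.
have sz : size (sort <=%O (codom a)) == n by rewrite size_sort size_codom card_ord.
have sA : sorted <=%O (Tuple sz) by apply: sort_le_sorted.
pose A : sym_vertex I n := exist _ (Tuple sz) sA.
exists A; have /tuple_permP[s sE] : perm_eq (val A) [tuple a i | i < n].
  by rewrite perm_sort codomE.
rewrite (sym_proj_perm he _ s); congr (sym_proj _ _ (tensor _)).
apply/ffunP => i; rewrite !ffunE; congr e.
have /val_inj AE := sE.
by rewrite /entry AE !tnth_mktuple.
Qed.

Lemma sym_basis_is_basis : is_basis (sym_basis e n).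
Proof.
split=> [x|c c0]; last first.
  by apply/malgP => B; rewrite -sym_coord_lincomb c0 linear0 mcoeff0.
pose P x := exists A, x = sym_basis e n A.
(* Modulo the span of the sorted monomials, the projection of [V^{(x) n}] kills
   every basis tensor, hence is zero by multilinearity. *)
suff /boolp.asboolP[s [sP ->]] : x \in span P.
  elim: s sP => [|[a y] s IH] sP.
    by exists 0; rewrite big_nil linear0.
  have [|c cE] := IH; first by move=> p ps; apply: sP; rewrite inE ps orbT.
  have [A /= yE] := sP _ (mem_head _ _).
  exists (<< a *g A >> + c).
  by rewrite big_cons linearD /= lincombU cE yE.
rewrite -(subr0 x); apply/qprojP; rewrite linear0 -(qreprK x).
pose g : {linear tensor_power V n -> quot_mod P} := qproj P \o sym_proj e n.
apply: (tensor_ext (g := g) (h := \0)) => v /=.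
apply: (multilinear_ext he.1 (m1 := g \o @tensor f V n) (m2 := fun=> 0)).
- by move=> u i a y z; rewrite /= tensor_multilinear !linearP.
- by move=> u i a y z; rewrite scaler0 addr0.
move=> a /=; have [A] := sym_proj_basis_sort a; rewrite /basis_tensor => ->.
rewrite -(linear0 (qproj P)); apply/qprojP; rewrite subr0.
by apply: span_gen; exists A.
Qed.

End SymCoord.

(** * Coefficients of the action compared with the weights of the graph *)

Section SymWeight.
Variables (f : fieldType) (L : lieAlgType f) (V : lmodType f).
Variables (T : representation L V) (d : Order.disp_t) (I : orderType d).
Variables (e : I -> V) (he : is_basis e) (n : nat).
Implicit Types A B : sym_vertex I n.

(** Applying [sym_coord] to the expansion of [x] shows that the coordinates are the same for every
    proof [hS]. *)
Lemma coord_sym_basis (hS : is_basis (sym_basis e n)) x B :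
  (coord hS x)@_B = sym_coord he B x.
Proof. by rewrite -{2}(coordK hS x) sym_coord_lincomb. Qed.

(** Expand [x] in the basis: only [e y] with [y] completing [erase A i] to a rearrangement of [B]
    survives, and there is at most one such [y]. *)
Lemma sym_coord_subst A B i (x : V) :
  sym_coord_fun he B (subst_at [ffun k => e (entry A k)] i x) =
  if [pick j | erase A i == erase B j] is Some j then (coord he x)@_(entry B j)
  else 0.
Proof.
have xE y : sym_coord_fun he B (subst_at [ffun k => e (entry A k)] i (e y)) =
    (perm_eq (y :: erase A i) (val B))%:R.
  rewrite -(permPl (codom_subst_entry A i y)) -(sym_coord_basis he).
  by congr sym_coord_fun; apply/ffunP => k; rewrite !ffunE; case: eqP.
rewrite -{1}(coordK he x).
rewrite -[LHS]/(multilinear_at (sym_coord_multilinear he B) _ i _).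
rewrite linear_sum.
under eq_bigr => y _ do rewrite linearZ /= /multilinear_at_fun xE.
case: pickP => [j /eqP Eij|none].
  under eq_bigr => y _ do rewrite (perm_cons_erase _ Eij).
  exact: sum_mcoeff_eq.
rewrite big1 // => y _; rewrite perm_cons_eraseF ?scaler0 // => j /eqP.
by rewrite none.
Qed.

Lemma sym_rep_coord (hS : is_basis (sym_basis e n)) A B l :
  diagram_weight (sym_rep T he n) hS A B l =
  \sum_(i < n) if [pick j | erase A i == erase B j] is Some j
    then diagram_weight T he (entry A i) (entry B j) l else 0.
Proof.
rewrite /= /diagram_form coord_sym_basis /sym_basis /basis_tensor.
rewrite [sym_rep _ _ _ _ _]sym_actE [tensor_rep _ _ _ _]tensor_actE !linear_sum.
apply: eq_bigr => i _; rewrite sym_coordE.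
have -> : [ffun k => e ([ffun k => entry A k] k)] = [ffun k => e (entry A k)].
  by apply/ffunP => k; rewrite !ffunE.
by rewrite sym_coord_subst ffunE.
Qed.

(** Unlike in [sym_weightE], no edge is assumed: if none is found, the weight in [G] or its multiple
    is zero, and both sides vanish. *)
Lemma sym_weight_erase (W : zmodType) (G : wdigraph W I) A B i j :
  A != B -> erase A i = erase B j -> sym_weight G A B = sym_edge_weight G A B (i, j).
Proof.
move=> AB E; rewrite /sym_weight (negbTE AB).
case: pickP => [[k m] /and3P[/eqP E' _ _]|/(_ (i, j))].
  by rewrite /sym_edge_weight; have [/= -> ->] := erase_entry_uniq AB E E'.
rewrite /sym_edge_via E eqxx edgeE /=.
have [w0|_ /negbFE/eqP->//] := eqVneq (weight G (entry A i) (entry B j)) 0.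
by rewrite /sym_edge_weight w0 mul0rn.
Qed.

Lemma sym_weight_sum (W : zmodType) (G : wdigraph W I) A B :
  sym_weight G A B =
  \sum_(i < n) if [pick j | erase A i == erase B j] is Some j
    then weight G (entry A i) (entry B j) else 0.
Proof.
have [<-|AB] := eqVneq A B.
  rewrite /sym_weight eqxx; apply: eq_bigr => i _.
  (* The chosen [j] may differ from [i], but carries the same entry. *)
  case: pickP => [j /eqP Eij|/(_ i)]; last by rewrite eqxx.
  congr weight; apply/eqP; rewrite -(perm_cons_erase _ Eij) perm_sym.
  exact: perm_erase.
have [/existsP[i0 /existsP[j0 /eqP E]]|none] :=
    boolP [exists i, exists j, erase A i == erase B j]; last first.
  rewrite /sym_weight (negbTE AB) big1 => [|i _].
    case: pickP => // -[i j] /and3P[ij _ _].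
    by case/negP: none; apply/existsP; exists i; apply/existsP; exists j.
  case: pickP => // j ij.
  by case/negP: none; apply/existsP; exists i; apply/existsP; exists j.
rewrite (sym_weight_erase _ AB E) /sym_edge_weight /=.
(* The multiplicity becomes a sum of indicators over the indices, so the two sides can be compared
   term by term. *)
rewrite -[in count_mem _ _]codom_entry count_codom -sumrMnr; apply: eq_bigr => i _.
rewrite ffunE /=; case: eqP => [Ai|Ai].
  have Eij := etrans (erase_entry Ai) E.
  case: pickP => [j /eqP Eij'|/(_ j0)]; last by rewrite Eij eqxx.
  by have [_ <-] := erase_entry_uniq AB Eij Eij'; rewrite Ai.
(* A match for [i] would force its entry to equal that at [i0]. *)
case: pickP => // j /eqP Eij.
by case: Ai; have [] := erase_entry_uniq AB Eij E.
Qed.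

End SymWeight.

Theorem proposition7 (f : fieldType) (L : lieAlgType f) (V : lmodType f)
  (T : representation L V) (d : Order.disp_t) (I : orderType d) (e : I -> V)
  (he : is_basis e) (n : nat) :
  exists hS : is_basis (sym_basis e n),
    sym_graph n (diagram T he) = diagram (sym_rep T he n) hS.
Proof.
exists (sym_basis_is_basis he n); apply: wdigraphP => A B.
rewrite [LHS]sym_weight_sum; apply: dualP => l.
rewrite [RHS]sym_rep_coord dual_sumE.
by apply: eq_bigr => i _; case: pickP.
Qed.
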